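(* Consider $N$ steered particles with states $g_k=(R_k,r_k)\in SE(3)$ and dynamics $\dot g_k=g_k\hat\xi_k$, $\xi_k=(e_1^T,u_k^T)^T\in\mathbb{R}^6$, $k=1,\dots,N$. Let $$\xi_k^a=\begin{bmatrix}x_k+r_k\times R_ku_k\\ R_ku_k\end{bmatrix}\in\mathbb{R}^6,\qquad k=1,\dots,N,$$ where $x_k=R_ke_1$, be the twists expressed in the spatial (inertial) frame. The following statements are equivalent: (i) The system is at a relative equilibrium. (ii) The twists $\xi_k^a$ are equal for $k=1,2,\dots,N$, i.e. the algebraic condition $\tilde\Pi\,\xi^a=0$ is satisfied, where $\tilde\Pi=\left(I_N-\frac1N\mathbf{1}_N\mathbf{1}_N^T\right)\otimes I_6$ and $\xi^a=\mathrm{col}(\xi_1^a,\dots,\xi_N^a)\in\mathbb{R}^{6N}$.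
   Context: Model: particle $k$ has position $r_k\in\mathbb{R}^3$ and right-handed orthonormal frame $R_k=[x_k,y_k,z_k]\in SO(3)$, with $x_k$ its unit velocity vector. The control is $u_k=(w_k,-h_k,q_k)^T\in\mathbb{R}^3$ and the dynamics are $\dot r_k=x_k$, $\dot R_k=R_k\hat u_k$, where $\hat u$ is the skew-symmetric matrix with $\hat u v=u\times v$. Equivalently $\dot g_k=g_k\hat\xi_k$ with $g_k=\begin{bmatrix}R_k&r_k\\0&1\end{bmatrix}$ and $\hat\xi_k=\begin{bmatrix}\hat u_k&e_1\\0&0\end{bmatrix}\in\mathfrak{se}(3)$; $e_1,e_2,e_3$ is the standard basis of $\mathbb{R}^3$. The twist in spatial coordinates is $\xi_k^a=\mathrm{Ad}_{g_k}\xi_k$, where $\mathrm{Ad}_{g_k}=\begin{bmatrix}R_k&\hat r_kR_k\\0&R_k\end{bmatrix}$. The shape variables are $g_{kj}=g_k^{-1}g_j\in SE(3)$, $k,j=1,\dots,N$. A relative equilibrium is an equilibrium of the (reduced) dynamics of the shape variables: the system is at a relative equilibrium when $\dot g_{kj}=0$ for all $k,j$. $\mathbf{1}_N=(1,\dots,1)^T\in\mathbb{R}^N$, $\otimes$ is the Kronecker product, and $\mathrm{col}$ denotes stacking. *)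

(* Defs.v *)
From HB Require Import structures.
From mathcomp Require Export all_boot all_order all_algebra mxtens.
From mathcomp Require Export all_classical all_reals all_analysis.
Export Order.TTheory GRing.Theory Num.Theory.
Export numFieldNormedType.Exports.

Set Implicit Arguments.
Unset Strict Implicit.
Unset Printing Implicit Defensive.

Local Open Scope classical_set_scope.
Local Open Scope ring_scope.

Definition e1 (R : realType) : 'cV[R]_3 := delta_mx 0 0.

(* Index arithmetic is in 'I_3, hence cyclic. *)
Definition cross (R : realType) (u v : 'cV[R]_3) : 'cV[R]_3 :=
  \col_(i < 3) (u (i + 1) 0 * v (i + 2) 0 - u (i + 2) 0 * v (i + 1) 0).

(* The j-th column is u x e_j; see hatE. *)
Definition hat (R : realType) (u : 'cV[R]_3) : 'M[R]_3 :=
  \matrix_(i < 3, j < 3) cross u (delta_mx j 0) i 0.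

Lemma hatE (R : realType) (u v : 'cV[R]_3) : hat u *m v = cross u v.
Proof.
have delta_sum (a : 'I_3) : \sum_(j < 3) (a == j)%:R * v j 0 = v a 0.
  rewrite (bigD1 a) //= eqxx mul1r big1 ?addr0 // => j.
  by rewrite eq_sym => /negPf ->; rewrite mul0r.
apply/colP => i; rewrite !mxE.
under eq_bigr => j _ do rewrite !mxE !andbT mulrBl -!mulrA.
by rewrite sumrB -!mulr_sumr !delta_sum.
Qed.

Definition SO3 (R : realType) : set 'M[R]_3 :=
  [set Q | Q^T *m Q = 1%:M /\ \det Q = 1].

Definition SE3 (R : realType) : set 'M[R]_(3 + 1) :=
  [set g | exists Q r, SO3 Q /\ g = block_mx Q r 0 1%:M].

Definition frame (R : realType) (g : 'M[R]_(3 + 1)) : 'M[R]_3 := ulsubmx g.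

Definition position (R : realType) (g : 'M[R]_(3 + 1)) : 'cV[R]_3 := ursubmx g.

(* Twists list the linear part first. *)
Definition se3_hat (R : realType) (xi : 'cV[R]_(3 + 3)) : 'M[R]_(3 + 1) :=
  block_mx (hat (dsubmx xi)) (usubmx xi) 0 0.

Definition body_twist (R : realType) (u : 'cV[R]_3) : 'cV[R]_(3 + 3) :=
  col_mx (e1 R) u.

Definition spatial_twist (R : realType) (g : 'M[R]_(3 + 1)) (u : 'cV[R]_3) :
    'cV[R]_(3 + 3) :=
  col_mx (frame g *m e1 R + cross (position g) (frame g *m u)) (frame g *m u).

Definition Ad (R : realType) (g : 'M[R]_(3 + 1)) : 'M[R]_(3 + 3) :=
  block_mx (frame g) (hat (position g) *m frame g) 0 (frame g).

Lemma spatial_twistE (R : realType) (g : 'M[R]_(3 + 1)) (u : 'cV[R]_3) :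
  spatial_twist g u = Ad g *m body_twist u.
Proof.
by rewrite /Ad /body_twist mul_block_col mul0mx add0r -mulmxA hatE.
Qed.

(* J is the set of times on which the motion takes place; values of g and u
   outside J are irrelevant. *)
Definition is_motion (R : realType) (N : nat) (J : set R)
    (g : 'I_N -> R -> 'M[R]_(3 + 1)) (u : 'I_N -> R -> 'cV[R]_3) : Prop :=
  forall k t, J t ->
    SE3 (g k t) /\
    is_derive t 1 (g k) (g k t *m se3_hat (body_twist (u k t))).

Definition shape (R : realType) (N : nat) (g : 'I_N -> R -> 'M[R]_(3 + 1))
    (k j : 'I_N) (t : R) : 'M[R]_(3 + 1) :=
  invmx (g k t) *m g j t.

Definition relative_equilibrium (R : realType) (N : nat)
    (g : 'I_N -> R -> 'M[R]_(3 + 1)) (t : R) : Prop :=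
  forall k j, is_derive t 1 (shape g k j) 0.

(* Row (k, i) of the stack, in the indexing of the Kronecker product *t,
   is entry i of v k. *)
Definition stack (R : realType) (N n : nat) (v : 'I_N -> 'cV[R]_n) :
    'cV[R]_(N * n) :=
  \col_l v (mxtens_unindex l).1 (mxtens_unindex l).2 0.

Definition Pi_tilde (R : realType) (N : nat) : 'M[R]_(N * (3 + 3)) :=
  (1%:M - N%:R^-1 *: (const_mx 1 *m (const_mx 1 : 'cV[R]_N)^T))
    *t (1%:M : 'M[R]_(3 + 3)).

(* Main.v *)
(* Since the spatial twist is the body twist transported by the adjoint action,
   [hat xi^a g = g hat xi], differentiating [g_kj = g_k^-1 g_j] gives
   [g_kj' = g_k^-1 (hat xi_j^a - hat xi_k^a) g_j], which vanishes if and only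
   if [xi_j^a = xi_k^a].  Applying [Pi_tilde] subtracts from each twist the mean
   of all the twists, so its kernel is the set of stacks of equal twists. *)
Require Import Defs.
From mathcomp Require Import perm ring.

Set Implicit Arguments.
Unset Strict Implicit.
Unset Printing Implicit Defensive.

Local Open Scope classical_set_scope.
Local Open Scope ring_scope.

Lemma is_derive_mxP (R : realFieldType) (V : normedModType R) (m n : nat)
    (A : V -> 'M[R]_(m, n)) (x v : V) (dA : 'M[R]_(m, n)) :
  is_derive x v A dA <->
  forall i j, is_derive x v (fun y => A y i j) (dA i j).
Proof.
split=> [[dvA <-] i j | dvA].
  rewrite derive_mx// mxE; apply: derivableP.
  exact: (derivable_mxP _ _ _).1 dvA i j.
have dA' : derivable A x v.
  by apply/derivable_mxP => i j; have [] := dvA i j.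
by split=> //; rewrite derive_mx//; apply/matrixP => i j;
  rewrite mxE derive_val.
Qed.

Lemma is_derive_mulmx (R : realFieldType) (V : normedModType R) (m n p : nat)
    (A : V -> 'M[R]_(m, n)) (B : V -> 'M[R]_(n, p)) (x v : V)
    (dA : 'M[R]_(m, n)) (dB : 'M[R]_(n, p)) :
  is_derive x v A dA -> is_derive x v B dB ->
  is_derive x v (fun y => A y *m B y) (dA *m B x + A x *m dB).
Proof.
move=> /is_derive_mxP hA /is_derive_mxP hB; apply/is_derive_mxP => i j.
have -> : (fun y => (A y *m B y) i j) =
    \sum_k ((fun y => A y i k) * (fun y => B y k j)).
  by apply/funext => y; rewrite fct_sumE mxE.
rewrite !mxE -big_split/=.
apply: is_derive_sum => k; apply: is_derive_eq.
by rewrite addrC; congr (_ + _); exact: mulrC.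
Qed.

(** By the Leibniz formula the determinant is a polynomial in the entries, hence built from
    derivable functions by sums and products. *)
Lemma derivable_det (R : realFieldType) (V : normedModType R) (n : nat)
    (A : V -> 'M[R]_n) (x v : V) :
  derivable A x v -> derivable (fun y => \det (A y)) x v.
Proof.
move=> /derivable_mxP hA.
have -> : (fun y => \det (A y)) =
    \sum_(s : 'S_n) (cst ((-1) ^+ s) * \prod_i (fun y => A y i (s i))).
  apply/funext => y; rewrite fct_sumE; apply: eq_bigr => s _.
  by rewrite /= fct_prodE.
apply: (big_ind (fun f : V -> R => derivable f x v)) => [|? ?|s _].
- exact: derivable_cst.
- exact: derivableD.
- apply: derivableM; first exact: derivable_cst.
  apply: (big_ind (fun f : V -> R => derivable f x v)) => [|? ?|i _].
  + exact: derivable_cst.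
  + exact: derivableM.
  + exact: hA.
Qed.

Lemma near_unitmx (R : realFieldType) (n : nat) (A : R -> 'M[R]_n) (x : R) :
  A x \in unitmx -> derivable A x 1 -> \forall y \near x, A y \in unitmx.
Proof.
rewrite unitmxE unitfE => det_neq0 /derivable_det/derivable1_diffP.
move=> /differentiable_continuous det_cont.
near=> y; rewrite unitmxE unitfE; near: y.
exact: (cvgr_neq0 (\det (A x)) _ det_neq0).
Unshelve. all: by end_near. Qed.

Lemma derivable_invmx (R : realFieldType) (n : nat) (A : R -> 'M[R]_n) (x : R) :
  A x \in unitmx -> derivable A x 1 -> derivable (fun y => invmx (A y)) x 1.
Proof.
move=> unitA dA; have near_unit := near_unitmx unitA dA.
(* On singular matrices [invmx] is the identity map by default, so the adjugate formula is available
   only on the neighbourhood where [A y] stays invertible. *)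
apply: (@near_eq_derivable _ _ _ (fun y => (\det (A y))^-1 *: \adj (A y))).
  by near=> y; rewrite /invmx ifT//; near: y.
apply/derivable_mxP => i j.
have -> : (fun y => ((\det (A y))^-1 *: \adj (A y)) i j) =
    (fun y => (\det (A y))^-1) *
    (cst ((-1) ^+ (j + i)) * (fun y => \det (row' j (col' i (A y))))).
  by apply/funext => y; rewrite !mxE.
apply: derivableM.
  apply: derivableV; last exact: derivable_det.
  by move: unitA; rewrite unitmxE unitfE.
apply: derivableM; first exact: derivable_cst.
apply: derivable_det; apply/derivable_mxP => k l.
under eq_fun do rewrite !mxE.
exact: (derivable_mxP _ _ _).1.
Unshelve. all: by end_near. Qed.

(** The product of [A y] and its inverse is constantly 1 near [x]; differentiating it by the product
    rule and solving gives the derivative of the inverse, whose existence is already known. *)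
Lemma is_derive_invmx (R : realFieldType) (n : nat) (A : R -> 'M[R]_n) (x : R)
    (dA : 'M[R]_n) :
  A x \in unitmx -> is_derive x 1 A dA ->
  is_derive x 1 (fun y => invmx (A y)) (- (invmx (A x) *m dA *m invmx (A x))).
Proof.
move=> unitA hA.
have near_unit := near_unitmx unitA (@ex_derive _ _ _ _ _ _ _ hA).
have hinv := derivableP (derivable_invmx unitA (@ex_derive _ _ _ _ _ _ _ hA)).
apply: is_derive_eq.
have h1 := is_derive_mulmx hA hinv.
have h0 : is_derive x 1 (fun y => A y *m invmx (A y)) 0.
  have : is_derive x 1 (cst 1%:M : R -> 'M[R]_n) 0 by exact: is_derive_cst.
  by apply: near_eq_is_derive; near=> y; rewrite mulmxV//; near: y.
have := @derive_val _ _ _ _ _ _ _ h1; rewrite (@derive_val _ _ _ _ _ _ _ h0).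
move=> /esym/eqP; rewrite addrC addr_eq0.
move=> /eqP /(congr1 (mulmx (invmx (A x)))).
by rewrite mulmxA mulVmx// mul1mx => ->; rewrite mulmxN mulmxA.
Unshelve. all: by end_near. Qed.

(** Entry (i, j) on the left is the triple product of [Q e_i], [Q u], [Q e_j], a determinant from
    which [\det Q] factors out. *)
Lemma hat_mulmx (R : realType) (Q : 'M[R]_3) (u : 'cV[R]_3) :
  Q^T *m hat (Q *m u) *m Q = \det Q *: hat u.
Proof.
(* With entries indexed by naturals, the cyclic and lifted indices compute and
   [ring] identifies the atoms. *)
have [q ->] : exists q : nat -> nat -> R, Q = \matrix_(i, j) q i j.
  exists (fun i j => Q (inord i) (inord j)).
  by apply/matrixP => i j; rewrite mxE !inord_val.
have [w ->] : exists w : nat -> R, u = \col_i w i.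
  by exists (fun i => u (inord i) 0); apply/colP => i; rewrite mxE inord_val.
apply/matrixP => i j; rewrite mxE [RHS]mxE.
rewrite (expand_det_row _ 0) /cofactor.
under [X in _ = X * _]eq_bigr => k _.
  rewrite (expand_det_row _ 0) /cofactor.
  under eq_bigr do rewrite det_mx11 !mxE.
  over.
rewrite !big_ord_recr !big_ord0 !mxE !big_ord_recr !big_ord0 !mxE.
rewrite !big_ord_recr !big_ord0 !mxE.
move: i j => [[|[|[|//]]] hi] [[|[|[|//]]] hj].
all: rewrite /= /eq_op /= /bump /modn /=; ring.
Qed.

Lemma hat_rotation (R : realType) (Q : 'M[R]_3) (u : 'cV[R]_3) :
  SO3 Q -> hat (Q *m u) *m Q = Q *m hat u.
Proof.
move=> [QTQ detQ]; have := hat_mulmx Q u; rewrite detQ scale1r => <-.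
by rewrite !mulmxA (mulmx1C QTQ) mul1mx.
Qed.

Lemma hat_inj (R : realType) : injective (@hat R).
Proof.
move=> a b ab; apply/colP => i.
(* In cyclic indexing, the entry of [hat a] at (i + 2, i + 1) is the coordinate [a i]. *)
have : hat a (i + 2) (i + 1) = hat b (i + 2) (i + 1) by rewrite ab.
have i22 : i + 2 + 2 = i + 1 by rewrite -addrA; congr (_ + _); exact: val_inj.
have i21 : i + 2 + 1 = i.
  by rewrite -addrA -[RHS]addr0; congr (_ + _); exact: val_inj.
have ii1 : (i == i + 1) = false by rewrite -{1}[i]addr0 (inj_eq (addrI i)).
by rewrite !mxE i22 i21 eqxx ii1 !mulr1 !mulr0 !subr0.
Qed.

Lemma cross_antisym (R : realType) (a b : 'cV[R]_3) : cross a b = - cross b a.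
Proof. by apply/colP => i; rewrite !mxE opprB; congr (_ - _); rewrite mulrC. Qed.

Lemma se3_hat_inj (R : realType) : injective (@se3_hat R).
Proof.
move=> a b /eq_block_mx[/hat_inj ab_ang ab_lin _ _].
by rewrite -[a]vsubmxK -[b]vsubmxK ab_ang ab_lin.
Qed.

Lemma SE3_unitmx (R : realType) (g : 'M[R]_(3 + 1)) : SE3 g -> g \in unitmx.
Proof.
move=> [Q [r [[_ detQ] ->]]].
by rewrite unitmxE det_ublock detQ det1 mulr1 unitr1.
Qed.

(** The rotation blocks agree because rotations preserve the cross product. In the translation
    column, [Q u x r] from the product cancels [r x Q u] from the spatial twist. *)
Lemma se3_hat_spatial_twist (R : realType) (g : 'M[R]_(3 + 1)) (u : 'cV[R]_3) :
  SE3 g -> se3_hat (spatial_twist g u) *m g = g *m se3_hat (body_twist u).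
Proof.
move=> [Q [r [SO3Q ->]]].
rewrite /se3_hat /spatial_twist /body_twist /frame /position.
rewrite block_mxKul block_mxKur !col_mxKd !col_mxKu !mulmx_block.
rewrite !mulmx0 !mul0mx !mulmx1 !addr0 hatE (hat_rotation _ SO3Q).
by rewrite (cross_antisym r) addrCA subrr addr0.
Qed.

Lemma is_derive_shape (R : realType) (N : nat) (J : set R)
    (g : 'I_N -> R -> 'M[R]_(3 + 1)) (u : 'I_N -> R -> 'cV[R]_3)
    (hg : is_motion J g u) (t : R) (ht : J t) (k j : 'I_N) :
  is_derive t 1 (shape g k j)
    (invmx (g k t) *m (se3_hat (spatial_twist (g j t) (u j t)) -
                       se3_hat (spatial_twist (g k t) (u k t))) *m g j t).
Proof.
have [gk dgk] := hg k t ht; have [gj dgj] := hg j t ht.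
have unitk := SE3_unitmx gk.
apply: is_derive_eq; first exact: is_derive_mulmx (is_derive_invmx _ dgk) dgj.
(* Moving both velocities to the spatial frame puts [g k t] next to its inverse, where the two
   cancel. *)
rewrite -!se3_hat_spatial_twist//.
rewrite mulmxBr mulmxBl addrC mulNmx !mulmxA; congr (_ - _ *m _).
by rewrite mulmxK.
Qed.

Lemma Pi_tilde_stackE (R : realType) (N : nat) (v : 'I_N -> 'cV[R]_(3 + 3))
    (k : 'I_N) (i : 'I_(3 + 3)) :
  (Pi_tilde R N *m stack v) (mxtens_index (k, i)) 0 =
  v k i 0 - N%:R^-1 * \sum_j v j i 0.
Proof.
transitivity
    (\sum_j \sum_l ((k == j)%:R - N%:R^-1) * (i == l)%:R * v j l 0).
  (* Columns of the Kronecker product are reindexed by pairs (particle, coordinate), so each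
     coefficient splits into a factor for each. *)
  rewrite mxE (reindex (@mxtens_index N (3 + 3))) /=; last first.
    by exists (@mxtens_unindex N (3 + 3)) => l _;
      rewrite (mxtens_indexK, mxtens_unindexK).
  rewrite pair_bigA; apply: eq_bigr => -[j l] _.
  by rewrite !mxE !mxtens_indexK /= big_ord1 !mxE !mulr1.
transitivity (\sum_j ((k == j)%:R - N%:R^-1) * v j i 0).
  apply: eq_bigr => j _; rewrite (bigD1 i)//= eqxx mulr1 big1 ?addr0// => l.
  by rewrite eq_sym => /negPf ->; rewrite mulr0 mul0r.
under eq_bigr do rewrite mulrBl.
rewrite sumrB -mulr_sumr (bigD1 k)//= eqxx mul1r big1 ?addr0// => j.
by rewrite eq_sym => /negPf ->; rewrite mul0r.
Qed.

Theorem proposition1 (R : realType) (N : nat) (hN : (0 < N)%N)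
    (J : set R) (hJ : open J)
    (g : 'I_N -> R -> 'M[R]_(3 + 1)) (u : 'I_N -> R -> 'cV[R]_3)
    (hg : is_motion J g u) (t : R) (ht : J t) :
  let xi_a := fun k => spatial_twist (g k t) (u k t) in
  (relative_equilibrium g t <-> forall k j, xi_a k = xi_a j) /\
  ((forall k j, xi_a k = xi_a j) <-> Pi_tilde R N *m stack xi_a = 0).
Proof.
move=> xi_a; split; split.
- move=> equil k j; apply/esym/se3_hat_inj.
  (* Derivatives are unique, so the computed one is 0; the invertible factors [invmx (g k t)] and
     [g j t] are then stripped off. *)
  have := @derive_val _ _ _ _ _ _ _ (is_derive_shape hg ht k j).
  rewrite (@derive_val _ _ _ _ _ _ _ (equil k j)).
  have unitk := SE3_unitmx (hg k t ht).1.
  have unitj := SE3_unitmx (hg j t ht).1.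
  move=> /(congr1 (fun M => g k t *m M *m invmx (g j t))).
  rewrite mulmx0 mul0mx !mulmxA mulmxV// mul1mx mulmxK// => /esym/eqP.
  by rewrite subr_eq0 => /eqP.
- move=> xi_eq k j; have := is_derive_shape hg ht k j.
  by rewrite -/(xi_a k) -/(xi_a j) (xi_eq j k) subrr mulmx0 mul0mx.
- move=> xi_eq; apply/colP => l; have [k i] := mxtens_indexP l.
  rewrite Pi_tilde_stackE [RHS]mxE.
  under eq_bigr do rewrite (xi_eq _ k).
  (* The mean of [N] equal values is that value once [N] can be cancelled. *)
  have N_neq0 : N%:R != 0 :> R by rewrite pnatr_eq0 -lt0n.
  by rewrite sumr_const card_ord -[X in _ - _ * X]mulr_natl mulKf// subrr.
- move=> Pi0.
  (* The right-hand side does not depend on [k], so all twists coincide. *)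
  have mean k i : xi_a k i 0 = N%:R^-1 * \sum_j xi_a j i 0.
    by apply/eqP; rewrite -subr_eq0 -Pi_tilde_stackE Pi0 mxE.
  by move=> k j; apply/colP => i; rewrite !mean.
Qed.
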